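(* In the distributed file-bundle caching problem with $m=l+1$ identical caches, each of size $k$, and queries of length $l\ge 2$, there is a randomized online distributed caching algorithm with competitive ratio $2l\left(\ln(2l+1)-\ln\ln l+\frac12\right)$ with respect to the optimal offline algorithm using a single cache of size $k$.
   Context: Pages $\mathcal{O}=\{1,\dots,N\}$. Distributed file-bundle caching: there are $m$ caches, the contents at time $t$ being $C_t=\{C_t^i\}_{i=1}^m$ with $C_t^i\subset\mathcal{O}$, $|C_t^i|=k$. At each time $t$ a query $Q_t\subset\mathcal{O}$ with $|Q_t|=l$ arrives; the cost is $f(C_t,Q_t)=\prod_{i=1}^m\mathbb{1}_{\{Q_t\not\subseteq C_t^i\}}$ (a miss occurs iff no single cache contains the whole query); the cache contents are updated between queries, without knowledge of future queries. The total cost on $\sigma$ is $\mathrm{ALG}(\sigma)=\sum_t f(C_t,Q_t)$. The benchmark $\mathrm{OPT}(\sigma)$ is the number of misses of the optimal offline algorithm for the single-cache file-bundle problem with one cache of size $k$ (a miss at time $t$ means $Q_t\not\subseteq C_t$; upon a miss the cache must insert $Q_t$ by evicting pages, with no other changes allowed). A randomized algorithm has competitive ratio $r$ if $\mathbb{E}[\mathrm{ALG}(\sigma)]\le r\,\mathrm{OPT}(\sigma)+c$ for all $\sigma$, with $c$ independent of $\sigma$ and the expectation over the algorithm's internal randomness. *)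

(* Defs.v *)
From HB Require Import structures.
From mathcomp Require Import all_boot all_order all_algebra.
From mathcomp Require Import all_classical all_reals all_analysis.

Set Implicit Arguments.
Unset Strict Implicit.
Unset Printing Implicit Defensive.

Local Open Scope nat_scope.

(* The pages 1, ..., N are represented by 'I_N. *)
Definition query (N l : nat) := {Q : {set 'I_N} | #|Q| == l}.

Definition cache (N k : nat) := {C : {set 'I_N} | #|C| == k}.

Definition caches (N k m : nat) := {ffun 'I_m -> cache N k}.

Definition hit (N k l : nat) (C : cache N k) (Q : query N l) : bool :=
  val Q \subset val C.

Definition cost (N k l m : nat) (C : caches N k m) (Q : query N l) : nat :=
  \prod_(i < m) ~~ hit (C i) Q.

(* A deterministic online algorithm chooses the contents C_t as a function of
   the strictly earlier queries Q_1, ..., Q_{t-1}; on the empty history it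
   gives the initial contents.  The contents may be rearranged freely between
   two queries. *)
Definition online_alg (N k l m : nat) := seq (query N l) -> caches N k m.

Definition total_cost (N k l m : nat) (A : online_alg N k l m)
    (n : nat) (sigma : n.-tuple (query N l)) : nat :=
  \sum_(t < n) cost (A (take t sigma)) (tnth sigma t).

(* A probability distribution over deterministic online algorithms.  Since
   caches N k m is finite, ralg_measurable says that the contents after any
   given history form a random variable. *)
Record randomized_alg (R : realType) (N k l m : nat) := RandomizedAlg {
  ralg_display : measure_display;
  ralg_space : measurableType ralg_display;
  ralg_prob : probability ralg_space R;
  ralg_run : ralg_space -> online_alg N k l m;
  ralg_measurable : forall (h : seq (query N l)) (C : caches N k m),
    measurable [set w | ralg_run w h = C]%classic
}.
Arguments ralg_run {R N k l m} _ _ _.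

Definition expected_cost (R : realType) (N k l m : nat)
    (A : randomized_alg R N k l m)
    (n : nat) (sigma : n.-tuple (query N l)) : \bar R :=
  expectation (ralg_prob A) (fun w => ((total_cost (ralg_run A w) sigma)%:R)%R).

(* S t is the content of the single offline cache when the query of index t
   arrives.  Since contents have exactly k pages, a miss evicts exactly as many
   pages as it inserts. *)
Definition legal_schedule (N k l n : nat) (sigma : n.-tuple (query N l))
    (S : {ffun 'I_n.+1 -> cache N k}) : bool :=
  [forall t : 'I_n,
    let Q := tnth sigma t in
    let C := S (inord t) in
    let C' := S (inord t.+1) in
    if hit C Q then C' == C
    else hit C' Q && (val C' \subset val C :|: val Q)].

Definition misses (N k l n : nat) (sigma : n.-tuple (query N l))
    (S : {ffun 'I_n.+1 -> cache N k}) : nat :=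
  \sum_(t < n) ~~ hit (S (inord t)) (tnth sigma t).

(* The minimum also ranges over the initial content.  The default value n is
   harmless: misses sigma S <= n, and legal schedules exist if l <= k <= N. *)
Definition OPT (N k l n : nat) (sigma : n.-tuple (query N l)) : nat :=
  \big[Order.min/n]_(S : {ffun 'I_n.+1 -> cache N k} | legal_schedule sigma S)
    misses sigma S.

Definition has_competitive_ratio (R : realType) (N k l m : nat)
    (A : randomized_alg R N k l m) (r : R) : Prop :=
  exists c : R, forall (n : nat) (sigma : n.-tuple (query N l)),
    (expected_cost A sigma <= (r * (OPT k sigma)%:R + c)%:E)%E.

(* Main.v *)
Require Import Defs.
From HB Require Import structures.
From mathcomp Require Import all_boot all_order all_algebra.
From mathcomp Require Import all_classical all_reals all_analysis.
From mathcomp Require Import zify ring lra.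
(* Reimported because all_classical shadows lemmas such as subsetP. *)
From mathcomp Require Import fintype finset.

(** Removing from a set of K = k + q pages one of l + 1 disjoint groups of
    q = k / l pages gives l + 1 caches of size k, and every query inside the set
    avoids one of the groups: the caches simulate a single cache of size K.

    On that cache, run the randomized marking algorithm on the sequence of the
    pages of the successive queries.  In a phase whose K marked pages include g
    pages that were not marked in the previous phase, its expected cost is at
    most g (1 + ln (K / g)).  If OPT inserts F pages in total, summing
    g + (K - k) over the phases gives at most 2 F + O(1), and F is at most l
    times the number of misses of OPT.  It remains to check that
    g (1 + ln (K / g)) <= c (g + K - k) for
    c = ln (2 l + 1) - ln (ln l) + 1 / 2, where K <= (2 l + 1) (K - k).

    The contents may be rearranged for free, so the pages evicted by the marking
    algorithm are redrawn at each step; only their marginal probabilities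
    matter.  Both bounds are proved with potential functions of the current
    state, [mark_potential] and [opt_potential]. *)

Set Implicit Arguments.
Unset Strict Implicit.
Unset Printing Implicit Defensive.

Import Order.TTheory GRing.Theory Num.Theory.

Local Open Scope nat_scope.

(** * Counting over rotations modulo [n] *)

Lemma sum_rotation (n a g : nat) : g <= n ->
  \sum_(i < n) ((i + a) %% n < g) = g.
Proof.
case: n => [|n] gn; first by rewrite big_ord0; case: g gn.
transitivity (\sum_(i < n.+1) (i < g)).
  rewrite [RHS](reindex_inj (@GRing.addIr _ (inZp a))).
  by apply: eq_bigr => i _; rewrite /= modnDmr.
have -> : \sum_(i < n.+1) (i < g) = \sum_(i < n.+1 | i < g) 1.
  by rewrite [RHS]big_mkcond; apply: eq_bigr => i _; case: ifP.
by rewrite -(big_ord_widen _ (fun=> 1)) // sum_nat_const card_ord muln1.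
Qed.

Lemma sum_rotation_mul (n q i g : nat) : g <= n ->
  \sum_(w < n * q) ((i + w) %% n < g) = q * g.
Proof.
move=> gn; elim: q => [|q IHq]; first by rewrite muln0 big_ord0.
rewrite mulnSr big_split_ord /= IHq mulSnr; congr addn.
rewrite -[RHS](sum_rotation i gn); apply: eq_bigr => w _ /=.
by rewrite addnCA mulnC modnMDl addnC.
Qed.

Lemma sum_index (T : finType) (A : {set T}) (F : nat -> nat) :
  \sum_(x in A) F (index x (enum A)) = \sum_(i < #|A|) F i.
Proof.
rewrite big_enum_val; apply: eq_bigr => i _; congr F.
by rewrite (enum_val_nth (enum_default i)) index_uniq ?enum_uniq // -cardE.
Qed.

(** * Simulating one larger cache *)

(* The l + 1 caches are S minus one of l + 1 disjoint groups of q pages: a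
   query has only l pages, so it avoids one of the groups. *)
Lemma caches_simulate_larger_cache (N k l q : nat) (S : {set 'I_N}) :
  #|S| = k + q -> l.+1 * q <= k + q ->
  exists C : caches N k l.+1,
    forall Q : query N l, val Q \subset S -> cost C Q = 0.
Proof.
move=> cS lq.
pose grp (i : 'I_l.+1) := [set p in S | i * q <= index p (enum S) < i * q + q].
have grpq i : #|grp i| = q.
  rewrite -sum1_card /grp.
  under eq_bigl do rewrite inE.
  rewrite big_mkcondr /=.
  rewrite (sum_index S (fun x => if i * q <= x < i * q + q then 1 else 0)) cS.
  have iq : i * q + q <= k + q.
    by apply: leq_trans lq; rewrite -mulSnr leq_mul2r ltn_ord orbT.
  rewrite -(big_mkord xpredT
    (fun x => if i * q <= x < i * q + q then 1 else 0)).
  rewrite (big_cat_nat (n := i * q)) //=; last first.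
    by apply: leq_trans iq; exact: leq_addr.
  rewrite (big_cat_nat (m := i * q) (n := i * q + q)) //=; last exact: leq_addr.
  rewrite big_nat big1 => [|j jq]; last by case: ifP => //; lia.
  rewrite add0n big_nat [X in _ + X]big_nat.
  rewrite [X in _ + X]big1 => [|j jq]; last by case: ifP => //; lia.
  rewrite addn0 (eq_bigr (fun=> 1)) => [|j jq]; last by rewrite jq.
  by rewrite -big_nat sum_nat_const_nat; lia.
have cC i : #|S :\: grp i| == k.
  have sub : grp i \subset S by apply/subsetP => p; rewrite inE => /andP[].
  by rewrite cardsD (setIidPr sub) grpq cS addnK.
exists [ffun i => exist _ (S :\: grp i) (cC i)] => Q QS.
apply/eqP; rewrite /cost prod_nat_seq_eq0; apply: contraT => /hasPn miss.
have {}miss i : exists p, (p \in val Q) && (p \in grp i).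
  have := miss i (mem_index_enum _); rewrite /= eqb0 negbK /hit ffunE /=.
  move=> /subsetPn[p pQ]; rewrite inE (subsetP QS _ pQ) andbT negbK => pg.
  by exists p; rewrite pQ.
pose f i := xchoose (miss i).
have fQ i : f i \in val Q by have /andP[] := xchooseP (miss i).
have fg (i : 'I_l.+1) : i * q <= index (f i) (enum S) < i * q + q.
  by have /andP[_] := xchooseP (miss i); rewrite inE => /andP[].
have finj : injective f.
  move=> i j fij; apply: val_inj => /=.
  have := fg i; have := fg j; rewrite fij => /andP[h1 h2] /andP[h3 h4].
  by nia.
have : #|f @: [set: 'I_l.+1]| <= #|val Q|.
  by apply/subset_leq_card/subsetP => _ /imsetP[i _ ->].
by rewrite card_imset // cardsT card_ord (eqP (valP Q)) ltnn.
Qed.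

Lemma cardsD_leD (T : finType) (A B C : {set T}) :
  #|A :\: C| <= #|A :\: B| + #|B :\: C|.
Proof.
apply: leq_trans (leq_card_setU _ _); apply/subset_leq_card/subsetP => x.
by rewrite !inE => /andP[-> ->]; case: (x \in B).
Qed.

Lemma cardsD_addC (T : finType) (A B : {set T}) :
  #|A :\: B| + #|B| = #|B :\: A| + #|A|.
Proof.
by have := cardsID B A; have := cardsID A B; rewrite setIC; lia.
Qed.

(** * The randomized marking algorithm and its potentials *)

Section marking.
Variables (T : finType) (K : nat).

(* In a state (O, M), M contains the pages marked in the current phase and O
   those marked in the previous one. *)
Definition mark_state := ({set T} * {set T})%type.

Implicit Types (st : mark_state) (p : T) (C : {set T}).

Definition mark st p : mark_state :=
  if p \in st.2 then st
  else if #|st.2| < K then (st.1, p |: st.2) else (st.2, [set p]).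

Definition fresh st := #|st.2 :\: st.1|.

Definition stale st := #|st.1 :\: st.2|.

Definition mark_inv st := (#|st.1| == K) && (#|st.2| <= K).

Lemma stale_fresh st : mark_inv st -> stale st + #|st.2| = fresh st + K.
Proof. by move=> /andP[/eqP <- _]; exact: cardsD_addC. Qed.

Lemma fresh_le_stale st : mark_inv st -> fresh st <= stale st.
Proof. by move=> inv; have := stale_fresh inv; case/andP: inv; lia. Qed.

Lemma mark_invP st p : 0 < K -> mark_inv st -> mark_inv (mark st p).
Proof.
move=> K0 /andP[/eqP cO cM]; rewrite /mark /mark_inv; case: ifPn => pM.
  by rewrite cO eqxx.
case: ltnP => MK /=; first by rewrite cO eqxx cardsU1 pM.
by rewrite cards1 K0 andbT eqn_leq cM.
Qed.

(* The [fresh st] evicted pages are a window of the enumeration of the stale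
   pages, rotated by the random seed w; each stale page is thus evicted with
   probability fresh st / stale st. *)
Definition evicted st (w : nat) : {set T} :=
  [set p in st.1 :\: st.2 |
    (index p (enum (st.1 :\: st.2)) + w) %% stale st < fresh st].

Definition kept st w := st.2 :|: ((st.1 :\: st.2) :\: evicted st w).

Lemma card_evicted st w : mark_inv st -> #|evicted st w| = fresh st.
Proof.
move=> inv; rewrite -[RHS](sum_rotation w (fresh_le_stale inv)).
rewrite -(sum_index _ (fun i => (i + w) %% stale st < fresh st : nat)).
rewrite -sum1_card /evicted; under eq_bigl do rewrite inE.
by rewrite big_mkcondr; apply: eq_bigr => p _; case: ifP.
Qed.

Lemma card_kept st w : mark_inv st -> #|kept st w| = K.
Proof.
move=> inv; rewrite /kept cardsU.
have -> : st.2 :&: (st.1 :\: st.2 :\: evicted st w) = set0.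
  by apply/setP => p; rewrite !inE; case: (p \in st.2); rewrite ?andbF.
have sub : evicted st w \subset st.1 :\: st.2.
  by apply/subsetP => p; rewrite inE => /andP[].
have := cardsD (st.1 :\: st.2) (evicted st w).
rewrite (setIidPr sub) card_evicted // cards0 => ->.
by have := stale_fresh inv; have := fresh_le_stale inv; rewrite /stale; lia.
Qed.

Local Open Scope ring_scope.

Variable R : realType.

Definition miss_prob st p : R :=
  if p \in st.2 then 0
  else if p \in st.1 then (fresh st)%:R / (stale st)%:R else 1.

Lemma miss_prob_ge0 st p : 0 <= miss_prob st p.
Proof. by rewrite /miss_prob; do 2?case: ifP => // _; rewrite divr_ge0. Qed.

(** The hypothesis on [n] makes the seed exactly uniform modulo [stale st], whatever the state. *)
Lemma sum_notin_kept st p n : mark_inv st ->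
    (forall d, (0 < d <= #|T|)%N -> (d %| n)%N) ->
  \sum_(w < n) (p \notin kept st w)%:R = n%:R * miss_prob st p.
Proof.
move=> inv dvdn_n; rewrite /miss_prob; case: ifPn => pM.
  by rewrite mulr0 big1 // => w _; rewrite inE pM.
case: ifPn => pO; last first.
  rewrite mulr1 (eq_bigr (fun=> 1)) ?sumr_const ?card_ord // => w _.
  by rewrite !inE (negbTE pM) (negbTE pO) /= ?andbF.
have pU : p \in st.1 :\: st.2 by rewrite inE pM.
have U0 : (0 < stale st)%N by rewrite card_gt0; apply/set0Pn; exists p.
have /dvdnP[q ->] : (stale st %| n)%N by apply: dvdn_n; rewrite U0 max_card.
transitivity (\sum_(w < stale st * q)
    ((index p (enum (st.1 :\: st.2)) + w) %% stale st < fresh st)%:R : R).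
  rewrite mulnC; apply: eq_bigr => w _; congr (_%:R)%R; congr nat_of_bool.
  by rewrite inE (negbTE pM) orFb inE pU andbT negbK inE pU.
rewrite -natr_sum sum_rotation_mul ?fresh_le_stale // !natrM.
by field; rewrite pnatr_eq0 -lt0n.
Qed.

(** Bounds the expected cost of the phase so far; once [K] pages are marked,
    [stale st = fresh st = g] and it equals [g (1 + ln (K / g))]. *)
Definition mark_potential st : R :=
  (fresh st)%:R * (1 + ln K%:R - ln (stale st)%:R).

(** Marking pages of [C] never increases it, and a new phase lowers it by at least
    [fresh st + (K - #|C|)]. *)
Definition opt_potential st C : nat :=
  (#|st.2 :\: C| + fresh st + #|C :\: (st.1 :|: st.2)|)%N.

(** The first term grows by at most the number of evictions, the last by at most the equal number of
    insertions. *)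
Lemma opt_potential_move st C C' : #|C| = #|C'| ->
  (opt_potential st C' <= opt_potential st C + 2 * #|C' :\: C|)%N.
Proof.
move=> cC; rewrite /opt_potential.
have := cardsD_leD st.2 C C'; have := cardsD_leD C' C (st.1 :|: st.2).
by have := cardsD_addC C C'; lia.
Qed.

(** * Marking a page within a phase *)

Section unmarked_step.
Variables (st : mark_state) (p : T).
Hypotheses (inv : mark_inv st) (pM : p \notin st.2) (MK : (#|st.2| < K)%N).

Let st' : mark_state := (st.1, p |: st.2).

Lemma fresh_step : fresh st' = (fresh st + (p \notin st.1))%N.
Proof.
rewrite /fresh /=; case: (boolP (p \in st.1)) => pO /=.
  rewrite addn0; congr #|pred_of_set _|; apply/setP => x; rewrite !inE.
  by case: eqP => // ->; rewrite pO.
have -> : (p |: st.2) :\: st.1 = p |: (st.2 :\: st.1).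
  by apply/setP => x; rewrite !inE; case: eqP => // ->; rewrite pO.
by rewrite cardsU1 inE (negbTE pM) andbF addnC.
Qed.

Lemma stale_step : (stale st' + (p \in st.1) = stale st)%N.
Proof.
rewrite /stale (cardsD1 p (st.1 :\: st.2)) inE pM /= addnC; congr addn.
by congr #|pred_of_set _|; apply/setP => x; rewrite !inE negb_or -andbA.
Qed.

(** Marking [p] adds a fresh page or removes a stale one. Hence the pages of a query, all served
    from the state before it, can be charged one by one as they are marked. *)
Lemma miss_prob_step p' : p' != p -> miss_prob st p' <= miss_prob st' p'.
Proof.
move=> p'p; rewrite /miss_prob /= !inE (negbTE p'p) /=.
case: ifPn => // p'M; case: ifPn => // p'O.
have U0 : (0 < stale st')%N.
  by rewrite card_gt0; apply/set0Pn; exists p'; rewrite !inE negb_or p'p p'M.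
apply: ler_pM; rewrite ?invr_ge0 //.
  by rewrite ler_nat fresh_step leq_addr.
by rewrite lef_pV2 ?posrE ?ltr0n -?stale_step ?ler_nat ?leq_addr // addn_gt0 U0.
Qed.

(** A fresh page adds [1 + ln (K / stale st)], at least 1; a stale page turns [- ln (s + 1)] into
    [- ln s], a gain of at least [1 / (s + 1)] per fresh page. *)
Lemma mark_potential_step :
  mark_potential st + miss_prob st p <= mark_potential st'.
Proof.
have fs := fresh_le_stale inv; have sf := stale_fresh inv.
rewrite /mark_potential /miss_prob (negbTE pM) fresh_step.
case: ifPn stale_step => pO /= ss; rewrite -ss; last first.
  rewrite addn0 natrD mulrDl lerD2l mul1r.
  have U0 : (0 < stale st')%N by lia.
  have gM : (fresh st <= #|st.2|)%N by exact: subset_leq_card (subsetDl _ _).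
  rewrite -addrA lerDl subr_ge0 ler_ln ?posrE ?ltr0n ?ler_nat //; lia.
rewrite addn0; have [->|g0] := posnP (fresh st); first by rewrite !mul0r addr0.
have U0 : (0 < stale st')%N by lia.
rewrite -mulrDr ler_pM2l ?ltr0n //.
have sR : 0 < (stale st')%:R :> R by rewrite ltr0n.
rewrite natrD; set s : R := (stale st')%:R in sR *.
clear ss sf.
have h : ln (1 + - (s + 1)^-1) <= - (s + 1)^-1.
  by apply: le_ln1Dx; rewrite ltrN2 invf_lt1; lra.
have e : 1 + - (s + 1)^-1 = s / (s + 1) by field; rewrite gt_eqF; lra.
rewrite e ln_div ?posrE in h; lra.
Qed.

(** A page counted anew in [fresh] leaves the last term. *)
Lemma opt_potential_step C : p \in C ->
  opt_potential st' C = opt_potential st C.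
Proof.
move=> pC; rewrite /opt_potential fresh_step /=.
have -> : (p |: st.2) :\: C = st.2 :\: C.
  by apply/setP => x; rewrite !inE; case: eqP => // ->; rewrite pC.
have -> : #|C :\: (st.1 :|: st.2)| =
    ((p \notin st.1) + #|C :\: (st.1 :|: (p |: st.2))|)%N.
  rewrite (cardsD1 p) !inE pC (negbTE pM) orbF andbT; congr addn.
  congr #|pred_of_set _|; apply/setP => x; rewrite !inE.
  by case: (x == p); rewrite ?orbT.
by rewrite !addnA.
Qed.

End unmarked_step.

(** * Starting a new phase *)

Section reset_step.
Variables (st : mark_state) (p : T) (C : {set T}).
Hypotheses (pM : p \notin st.2) (MK : #|st.2| = K).
Hypothesis pC : p \in C.

Let st' : mark_state := (st.2, [set p]).

Lemma mark_potential_reset : mark_potential st' = 1.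
Proof.
rewrite /mark_potential /fresh /stale /=.
have -> : [set p] :\: st.2 = [set p].
  by apply/setP => x; rewrite !inE; case: eqP => [->|]; rewrite ?pM ?andbF.
have -> : st.2 :\: [set p] = st.2.
  by apply/setP => x; rewrite !inE; case: eqP => [->|] //=; rewrite (negbTE pM).
by rewrite MK cards1 mul1r addrK.
Qed.

(** As [p] is in [C] but not in [st.2], the new value is [#|C :\: st.2|], that is
    [#|st.2 :\: C| + #|C| - K]. *)
Lemma opt_potential_reset :
  (opt_potential st' C + fresh st + K <= opt_potential st C + #|C|)%N.
Proof.
rewrite /opt_potential /=.
have -> : [set p] :\: C = set0.
  by apply/setP => x; rewrite !inE; case: eqP => [->|] //=; rewrite ?pC ?andbF.
have -> : fresh st' = 1%N.
  rewrite /fresh /= -(cards1 p); congr #|pred_of_set _|; apply/setP => x.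
  by rewrite !inE; case: eqP => [->|]; rewrite ?pM ?andbF.
have : #|C :\: st.2| = #|C :\: (st.2 :|: [set p])|.+1.
  rewrite (cardsD1 p) !inE pC pM; congr addn.
  congr #|pred_of_set _|; apply/setP => x; rewrite !inE.
  by case: (x == p); case: (x \in st.2).
have := cardsD_addC C st.2; rewrite cards0 MK; lia.
Qed.

End reset_step.

(** * Amortized cost of a query *)

Section query_step.
Variables (k : nat) (c : R) (C : {set T}).
Hypotheses (kK : (k <= K)%N) (cC : #|C| = k) (K0 : (0 < K)%N) (c0 : 0 <= c).
Hypothesis phase_cost : (K < #|T|)%N -> forall g, (g <= K)%N ->
  g%:R * (1 + ln K%:R - ln g%:R) <= c * (g + (K - k))%:R.

Definition potential st C' : R :=
  mark_potential st - c * (opt_potential st C')%:R.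

(** Within a phase, [mark_potential] pays for each miss probability. If a phase ends during the
    query, the potential gains at least 1, which suffices thanks to the cap at 1. *)
Lemma potential_mark_ge (s : seq T) st : mark_inv st -> uniq s ->
  {subset s <= C} ->
  Num.min 1 (\sum_(p <- s) miss_prob st p) <=
    potential (foldl mark st s) C - potential st C.
Proof.
elim: s st => [|p s IHs] st inv /=.
  by rewrite big_nil subrr ge_min lexx orbT.
move=> /andP[ps us] sC.
have pC : p \in C by apply: sC; rewrite mem_head.
have {}sC : {subset s <= C} by move=> x xs; apply: sC; rewrite inE xs orbT.
have {}IHs := IHs (mark st p) (mark_invP p K0 inv) us sC.
rewrite big_cons; move: IHs; rewrite [mark st p]/mark; case: ifPn => pM.
  by rewrite {2}/miss_prob pM add0r.
case: ltnP => [MK|MK].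
  set st' := (st.1, p |: st.2) => IHs.
  have := mark_potential_step inv pM MK; rewrite -/st' => hm.
  have := opt_potential_step pM pC; rewrite -/st' => ho.
  have -> : potential (foldl mark st' s) C - potential st C =
      (mark_potential st' - mark_potential st) +
      (potential (foldl mark st' s) C - potential st' C).
    by rewrite /potential ho; ring.
  have h0 := miss_prob_ge0 st p.
  have hs : \sum_(j <- s) miss_prob st j <= \sum_(j <- s) miss_prob st' j.
    rewrite big_seq [leRHS]big_seq; apply: ler_sum => j js.
    by apply: miss_prob_step => //; apply: contraNneq ps => <-.
  move: IHs; rewrite !ge_min => /orP[h|h]; apply/orP; [left|right]; lra.
have {}MK : #|st.2| = K by apply/eqP; rewrite eqn_leq MK andbT; case/andP: inv.
set st' := (st.2, [set p]) => IHs.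
have KT : (K < #|T|)%N.
  rewrite -MK -cardsT; apply: proper_card; rewrite properT.
  by apply: contraNneq pM => ->; rewrite inE.
have gK : (fresh st <= K)%N.
  by rewrite -MK; exact: subset_leq_card (subsetDl _ _).
(* So the old [mark_potential] is the left side of [phase_cost] at [g = fresh st]. *)
have sf : stale st = fresh st by have := stale_fresh inv; lia.
have hc := phase_cost KT gK.
have hr := mark_potential_reset pM MK; have ho := opt_potential_reset pM MK pC.
have {}ho : c * (fresh st + (K - k))%:R <=
    c * (opt_potential st C)%:R - c * (opt_potential st' C)%:R.
  by rewrite -mulrBr ler_wpM2l // lerBrDr -natrD ler_nat /st'; lia.
have : 1 <= potential st' C - potential st C.
  rewrite /potential -/st' in hr *.
  by rewrite hr /mark_potential sf; clear sf MK; lra.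
have : 0 <= Num.min 1 (\sum_(p <- s) miss_prob st' p).
  by rewrite le_min ler01; apply: sumr_ge0 => j _; exact: miss_prob_ge0.
rewrite ge_min; clear sf MK cC; lra.
Qed.

End query_step.

End marking.

Local Open Scope ring_scope.

(** * Numerical estimates for the ratio *)

Lemma expR_Nhalf_le (R : realType) : expR (- 2^-1) <= 2 / 3 :> R.
Proof.
have h := expR_ge1Dx (2^-1 : R).
rewrite expRN -[2 / 3]invf_div lef_pV2 ?posrE ?expR_gt0 ?divr_gt0 //; lra.
Qed.

(** Tangent of [ln] at 3, with [ln 3 <= 3 / 2] from [expR (3 / 2) >= (3 / 2) ^ 3]. *)
Lemma ln_le_third (R : realType) (y : R) : 0 < y -> ln y <= y / 3 + 2^-1.
Proof.
move=> y0.
have ln3 : ln 3 <= 3 / 2 :> R.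
  rewrite -[leRHS]expRK ler_ln ?posrE ?expR_gt0 //.
  rewrite (expRM_natl 3); have h := expR_ge1Dx (2^-1 : R).
  have : (1 + 2^-1) ^+ 3 <= expR (2^-1) ^+ 3 :> R.
    by rewrite lerXn2r ?nnegrE ?expR_ge0 //; lra.
  by apply: le_trans; lra.
have y3 : 0 < y / 3 by rewrite divr_gt0.
have : ln (1 + (y / 3 - 1)) <= y / 3 - 1 by apply: le_ln1Dx; lra.
rewrite addrC subrK ln_div ?posrE //; lra.
Qed.

Definition marking_ratio (R : realType) (l : nat) : R :=
  ln (2 * l%:R + 1) - ln (ln l%:R) + 2^-1.

Section marking_ratio.
Variables (R : realType) (l : nat).
Hypothesis l_ge2 : (2 <= l)%N.

Let y_gt0 : 0 < ln l%:R :> R.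
Proof. by apply: ln_gt0; rewrite ltr1n. Qed.

Let l_gt0 : 0 < l%:R :> R.
Proof. by rewrite ltr0n; lia. Qed.

Let ln_le : ln (l%:R : R) <= ln (2 * l%:R + 1).
Proof. by have l0 := l_gt0; rewrite ler_ln ?posrE //; lra. Qed.

Lemma marking_ratio_ge_half : 2^-1 <= marking_ratio R l.
Proof.
have := ln_sublinear y_gt0; have := ln_le; rewrite /marking_ratio; lra.
Qed.

(** The left side is [ln l * expR (- 1 / 2)], at most [2 / 3 * ln l]; since
    [ln (ln l) <= ln l / 3 + 1 / 2], the right side is at least that. *)
Lemma expRN_marking_ratio :
  expR (- marking_ratio R l) * (2 * l%:R + 1) <= marking_ratio R l.
Proof.
have l1 : 0 < 2 * l%:R + 1 :> R by have := l_gt0; lra.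
rewrite /marking_ratio !opprD opprK !expRD expRN !lnK ?posrE //.
rewrite -2!mulrA mulrC -2!mulrA mulfV ?gt_eqF // mulr1.
have h : ln l%:R * expR (- 2^-1) <= ln l%:R * (2 / 3) :> R.
  by rewrite ler_pM2l // expR_Nhalf_le.
apply: le_trans h _; have := ln_le_third y_gt0; have := ln_le; lra.
Qed.

(* Tangent line of the concave function a |-> a * (1 - ln a). *)
Lemma mulr_1Bln_le (a c : R) : 0 < a -> a * (1 - ln a) <= expR (- c) + a * c.
Proof.
move=> a0; have z0 : 0 < expR (- c) / a by rewrite divr_gt0 ?expR_gt0.
have : ln (1 + (expR (- c) / a - 1)) <= expR (- c) / a - 1.
  by apply: le_ln1Dx; lra.
rewrite addrC subrK ln_div ?posrE ?expR_gt0 // expRK => h.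
have : a * (1 - ln a) <= a * (expR (- c) / a + c) by rewrite ler_pM2l //; lra.
by rewrite [leRHS]mulrDr mulrCA mulfV ?gt_eqF // mulr1.
Qed.

(** With [c] the ratio, the tangent bound at [g / K], times [K], gives [c g + K expR (- c)], whose
    last term is at most [c (K - k)]. *)
Lemma phase_cost_le (K k g : nat) : (k < K)%N -> (g <= K)%N ->
  (K <= (2 * l + 1) * (K - k))%N ->
  g%:R * (1 + ln K%:R - ln g%:R) <= marking_ratio R l * (g + (K - k))%:R.
Proof.
move=> kK gK Kl.
have c0 : 0 < marking_ratio R l by have := marking_ratio_ge_half; lra.
have [->|g0] := posnP g; first by rewrite mul0r mulr_ge0 // ltW.
have gR : 0 < g%:R :> R by rewrite ltr0n.
have KR : 0 < K%:R :> R by rewrite ltr0n; lia.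
have := mulr_1Bln_le (marking_ratio R l) (divr_gt0 gR KR).
rewrite ln_div ?posrE // => h.
have {h} := ler_wpM2l (ltW KR) h.
rewrite mulrA mulrCA mulfV ?gt_eqF // mulr1 opprB addrA => /le_trans; apply.
set c := marking_ratio R l.
have -> : K%:R * (expR (- c) + g%:R / K%:R * c) = c * g%:R + K%:R * expR (- c).
  by field; rewrite gt_eqF.
rewrite natrD mulrDr lerD2l /c.
have KlR : K%:R <= (2 * l%:R + 1) * (K - k)%:R :> R.
  by rewrite -[2]/(2%:R) -natrM natr1 -natrM ler_nat -addn1.
have e0 := expR_ge0 (- marking_ratio R l).
rewrite mulrC; apply: le_trans (ler_wpM2l e0 KlR) _.
by rewrite mulrA ler_wpM2r // expRN_marking_ratio.
Qed.

End marking_ratio.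

(** * Uniform random seeds *)

Section uniform_below.
Variables (R : realType) (n : nat).

Definition uniform_below : set nat -> \bar R :=
  mscale (n.+1%:R^-1)%:nng
    (msum (fun i => \d_i : {measure set nat -> \bar R}) n.+1).

HB.instance Definition _ := Measure.on uniform_below.

Let uniform_below_setT : uniform_below [set: nat] = 1%E.
Proof.
rewrite /uniform_below /mscale /msum /=.
rewrite /msum; rewrite (eq_bigr (fun=> 1%E)) => [|i _]; last exact: diracT.
rewrite sumEFin -EFinM sumr_const card_ord mulVf //.
Qed.

HB.instance Definition _ :=
  @Measure_isProbability.Build _ _ R uniform_below uniform_below_setT.

Lemma expectation_uniform_below (f : nat -> R) : (forall i, 0 <= f i) ->
  expectation uniform_below f = (n.+1%:R^-1 * \sum_(i < n.+1) f i)%:E.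
Proof.
move=> f0; rewrite unlock /uniform_below.
rewrite ge0_integral_mscale //=; last by move=> x _; rewrite lee_fin.
rewrite ge0_integral_measure_sum //=; last by move=> x _; rewrite lee_fin.
rewrite EFinM -sumEFin; congr (_ * _)%E; apply: eq_bigr => i _.
by rewrite integral_dirac //= diracT mul1e.
Qed.

End uniform_below.

Lemma cost_le1 (N k l m : nat) (C : caches N k m) (Q : query N l) :
  (cost C Q <= 1)%N.
Proof.
rewrite /cost; elim/big_ind: _ => // [x y x1 y1|i _]; last exact: leq_b1.
exact: leq_mul x1 y1.
Qed.

(** * Expected cost of one query *)

Section mark_query.
Variables (R : realType) (N l K : nat).

Definition mark_query (st : mark_state 'I_N) (Q : query N l) :=
  foldl (mark K) st (enum (val Q)).

Lemma mark_query_invP (st : mark_state 'I_N) (h : seq (query N l)) :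
  (0 < K)%N -> mark_inv K st -> mark_inv K (foldl mark_query st h).
Proof.
move=> K0; elim: h st => //= Q h IHh st inv; apply: IHh.
rewrite /mark_query; elim: (enum _) st inv => //= p s IHs st inv.
exact/IHs/mark_invP.
Qed.

(** Union bound over the pages of [Q] outside [kept st w], capped by the maximal cost 1. *)
Lemma mean_cost_le (k m : nat) (st : mark_state 'I_N) (Q : query N l)
    (C : {set 'I_N} -> caches N k m) : mark_inv K st ->
    (forall w, val Q \subset kept st w -> cost (C (kept st w)) Q = 0%N) ->
  N`!%:R^-1 * \sum_(w < N`!) (cost (C (kept st w)) Q)%:R <=
    Num.min 1 (\sum_(p <- enum (val Q)) miss_prob R st p).
Proof.
move=> inv C0; have n0 : 0 < N`!%:R :> R by rewrite ltr0n fact_gt0.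
rewrite mulrC le_min !ler_pdivrMr // ![_ * N`!%:R]mulrC; apply/andP; split.
  rewrite mulr1 (le_trans (ler_sum _ (G := fun=> 1) _)) //.
    by move=> w _; rewrite -[1]/(1%:R) ler_nat cost_le1.
  by rewrite sumr_const card_ord.
rewrite mulr_sumr.
under [leRHS]eq_bigr => p _.
  rewrite -(@sum_notin_kept _ K _ st p N`! inv).
    over.
  by move=> d; rewrite card_ord => ?; exact: dvdn_fact.
rewrite exchange_big; apply: ler_sum => w _ /=.
case: (boolP (val Q \subset kept st w)) => [/C0 ->|/subsetPn[p pQ pw]].
  by apply: sumr_ge0.
rewrite (big_rem p) ?mem_enum //= pw; apply: ler_wpDr; first exact: sumr_ge0.
by rewrite ler_nat cost_le1.
Qed.

End mark_query.

(** * Amortization along an offline schedule *)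

Lemma legal_schedule_step (N k l n : nat) (sigma : n.-tuple (query N l))
    (S : {ffun 'I_n.+1 -> cache N k}) (t : 'I_n) : legal_schedule sigma S ->
  let C := val (S (inord t)) in let C' := val (S (inord t.+1)) in
  val (tnth sigma t) \subset C' /\
  (#|C' :\: C| <= l * ~~ hit (S (inord t)) (tnth sigma t))%N.
Proof.
move=> /forallP /(_ t) /=; case: ifPn => [h /eqP ->|h /andP[h' sub]].
  by split=> //; rewrite setDv cards0.
split=> //; rewrite muln1 -(eqP (valP (tnth sigma t))).
apply/subset_leq_card/subsetP => x; rewrite inE => /andP[/negbTE xC].
by move/(subsetP sub); rewrite inE xC.
Qed.

Section schedule.
Variables (R : realType) (N k l K : nat) (c : R).
Hypotheses (kK : (k <= K)%N) (K0 : (0 < K)%N) (c0 : 0 <= c).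
Hypothesis phase_cost : (K < N)%N -> forall g, (g <= K)%N ->
  g%:R * (1 + ln K%:R - ln g%:R) <= c * (g + (K - k))%:R.
Variable st0 : mark_state 'I_N.
Hypothesis inv0 : mark_inv K st0.

Local Notation state := (foldl (@mark_query N l K) st0).

(** A bound independent of the query sequence, as states and contents are finitely many. *)
Definition potential_bound : R :=
  \sum_(x : mark_state 'I_N * {set 'I_N}) `|potential K c x.1 x.2|.

Lemma potential_le_bound (st : mark_state 'I_N) (C : {set 'I_N}) :
  `|potential K c st C| <= potential_bound.
Proof.
rewrite /potential_bound (bigD1 (st, C)) //= lerDl.
by apply: sumr_ge0 => x _.
Qed.

(** The potential telescopes: at each time the offline cache moves first, at a price of at most
    [2 * l * c] per offline miss, then the query is marked. *)
Lemma sum_miss_prob_le (n : nat) (sigma : n.-tuple (query N l))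
    (S : {ffun 'I_n.+1 -> cache N k}) : legal_schedule sigma S ->
  \sum_(t < n) Num.min 1
    (\sum_(p <- enum (val (tnth sigma t))) miss_prob R (state (take t sigma)) p)
  <= 2 * l%:R * c * (misses sigma S)%:R + 2 * potential_bound.
Proof.
move=> leg.
pose D t := potential K c (state (take t sigma)) (val (S (inord t))).
have step (t : 'I_n) : Num.min 1
    (\sum_(p <- enum (val (tnth sigma t))) miss_prob R (state (take t sigma)) p)
  <= (D t.+1 - D t) +
     2 * l%:R * c * (~~ hit (S (inord t)) (tnth sigma t))%:R.
  have [/subsetP QC dC] := legal_schedule_step t leg.
  have cC (i : 'I_n.+1) : #|val (S i)| = k by apply/eqP/(valP (S i)).
  have inv := mark_query_invP (take t sigma) K0 inv0.
  have := potential_mark_ge kK (cC (inord t.+1)) K0 c0.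
  rewrite card_ord => /(_ phase_cost (enum (val (tnth sigma t))) _ inv).
  move=> /(_ (enum_uniq _)) h; apply: le_trans (h _) _ => [p|].
    by rewrite mem_enum; exact: QC.
  have -> : foldl (mark K) (state (take t sigma)) (enum (val (tnth sigma t))) =
      state (take t.+1 sigma).
    rewrite (take_nth (tnth sigma t)) ?size_tuple // foldl_rcons.
    by rewrite -tnth_nth.
  have mv := @opt_potential_move _ (state (take t sigma)) _
    (val (S (inord t.+1))) (etrans (cC (inord t)) (esym (cC _))).
  rewrite /D /potential.
  have {}mv :
      (opt_potential (state (take t sigma)) (val (S (inord t.+1))))%:R <=
      (opt_potential (state (take t sigma)) (val (S (inord t))))%:R +
      2 * (l%:R * (~~ hit (S (inord t)) (tnth sigma t))%:R) :> R.
    by rewrite -!natrM -natrD ler_nat (leq_trans mv) // leq_add2l leq_mul2l.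
  have := ler_wpM2l c0 mv; lra.
apply: le_trans (ler_sum _ (fun t _ => step t)) _.
rewrite big_split /= -mulr_sumr -natr_sum addrC lerD2l.
rewrite -(big_mkord xpredT (fun t => D t.+1 - D t)) telescope_sumr //.
have := potential_le_bound (state (take n sigma)) (val (S (inord n))).
have := potential_le_bound (state (take 0 sigma)) (val (S (inord 0))).
rewrite !ler_norml -/(D n) -/(D 0%N) => /andP[? ?] /andP[? ?]; lra.
Qed.

End schedule.

(** * The competitive algorithm *)

Theorem theorem5p2 (R : realType) (N k l : nat)
    (hl : (2 <= l)%N) (hlk : (l <= k)%N) (hkN : (k <= N)%N) :
  exists A : randomized_alg R N k l l.+1,
    has_competitive_ratio A
      (2 * l%:R * (ln (2 * l%:R + 1) - ln (ln l%:R) + 2^-1)).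
Proof.
rewrite -/(marking_ratio R l); set c := marking_ratio R l.
have c2 : 2^-1 <= c by exact: marking_ratio_ge_half.
have c0 : 0 <= c by lra.
(* [k %/ l] is the largest [q] for which [l + 1] groups of [q] pages fit in [k + q] pages. *)
pose K := minn N (k + k %/ l).
have kl : (l * (k %/ l) <= k)%N by rewrite mulnC leq_trunc_div.
have klt : (k < (k %/ l).+1 * l)%N by rewrite ltn_ceil //; lia.
have kl0 : (0 < k %/ l)%N by rewrite divn_gt0; lia.
have kK : (k <= K)%N by rewrite /K; lia.
have K0 : (0 < K)%N by lia.
have KN : (K <= N)%N by rewrite /K; lia.
have phase_cost : (K < N)%N -> forall g, (g <= K)%N ->
    g%:R * (1 + ln K%:R - ln g%:R) <= c * (g + (K - k))%:R :> R.
  (* With [q = k %/ l >= 1], [k < (q + 1) l <= 2 q l] gives [K <= (2 l + 1) q]. *)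
  move=> ltKN g gK; have eK : K = (k + k %/ l)%N by move: ltKN; rewrite /K; lia.
  by apply: phase_cost_le => //; rewrite eK ?addKn; nia.
have [old0 cold0] : exists old0 : {set 'I_N}, #|old0| = K.
  exists [set widen_ord KN i | i : 'I_K].
  by rewrite card_imset ?card_ord // => i j /(congr1 val) /= /val_inj.
have inv0 : mark_inv K (old0, set0) by rewrite /mark_inv cold0 eqxx cards0.
have simul (S : {set 'I_N}) : #|S| = K -> exists C : caches N k l.+1,
    forall Q : query N l, val Q \subset S -> cost C Q = 0%N.
  move=> cS; apply: (@caches_simulate_larger_cache N k l (K - k)).
    by rewrite subnKC.
  by rewrite /K; nia.
have /boolp.choice[F FP] : forall S : {set 'I_N}, exists C : caches N k l.+1,
    #|S| = K -> forall Q : query N l, val Q \subset S -> cost C Q = 0%N.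
  move=> S; have [/simul[C CP]|nK] := pselect (#|S| = K); first by exists C.
  by have [C _] := simul _ cold0; exists C.
pose state := foldl (@mark_query N l K) (old0, set0).
(* One seed serves at all times: by linearity only the law of the contents at each time matters. *)
pose run (w : nat) : online_alg N k l l.+1 := fun h => F (kept (state h) w).
have run_meas h C : measurable [set w | run w h = C]%classic by [].
exists (@RandomizedAlg R N k l l.+1 _ _ (uniform_below R N`!.-1) run run_meas).
exists (2 * potential_bound N K c) => n sigma.
rewrite /expected_cost /= expectation_uniform_below //.
rewrite prednK ?fact_gt0 // lee_fin /total_cost.
under eq_bigr do rewrite natr_sum.
rewrite exchange_big mulr_sumr.
set E := (X in X <= _).
have inv h : mark_inv K (state h) by exact: mark_query_invP.
have El : E <= \sum_(t < n) Num.min 1 (\sum_(p <- enum (val (tnth sigma t)))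
    miss_prob R (state (take t sigma)) p).
  apply: ler_sum => t _; apply: mean_cost_le => // w.
  by apply: FP; exact: card_kept.
have B0 : 0 <= potential_bound N K c by apply: sumr_ge0.
rewrite /OPT; elim/big_ind: _ => [|x y Ex Ey|S leg].
(* For the default value [n] of the minimum: each query costs at most 1, and [2 * l * c >= 1]. *)
- apply: le_trans El _; apply: (@le_trans _ _ n%:R).
    rewrite -[n in n%:R]card_ord -sumr_const; apply: ler_sum => t _.
    by rewrite ge_min lexx.
  have : 1 <= 2 * l%:R * c.
    have : 2 <= l%:R :> R by rewrite -[2]/(2%:R) ler_nat.
    by nra.
  have : 0 <= n%:R :> R by [].
  by nra.
- by case: (leP x y).
- exact: le_trans El (sum_miss_prob_le kK K0 c0 phase_cost inv0 leg).
Qed.
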